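(* Let $\tau$ be a layered set partition of $[k]$ with exactly $r$ blocks, where $k>r$. Then $$A_n(\tau)=\Theta(1)^n\, n^{n\left(1-\frac{1}{k-r}\right)},$$ that is, there are constants $0<c\le C$ depending only on $\tau$ (not on $n$) such that $c^n n^{n\left(1-\frac{1}{k-r}\right)}\le A_n(\tau)\le C^n n^{n\left(1-\frac{1}{k-r}\right)}$ for all $n\ge 1$; and consequently $$\lim_{n\to\infty}F_n(\tau)=1-\frac{1}{k-r}.$$
   Context: For a positive integer $n$, $[n]=\{1,2,\dots,n\}$. A set partition of $[n]$ is a set of pairwise disjoint nonempty subsets of $[n]$ (called blocks) whose union is $[n]$. A set partition $\sigma$ of $[n]$ contains a set partition $\tau$ of $[k]$ if there are elements $x_1<x_2<\cdots<x_k$ of $[n]$ such that for all $i,j\in[k]$, $x_i$ and $x_j$ lie in the same block of $\sigma$ if and only if $i$ and $j$ lie in the same block of $\tau$. Otherwise $\sigma$ avoids $\tau$. $A_n(\tau)$ denotes the number of set partitions of $[n]$ avoiding $\tau$, and $F_n(\tau)=\frac{\log A_n(\tau)}{n\log n}$ (for $n\ge 2$). A set partition is layered if each of its blocks is a set of consecutive integers. *)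

(* Defs.v *)
(* The ground set [n] = {1, ..., n} is represented by the order-isomorphic 'I_n
   = {0, ..., n-1}. *)
From HB Require Import structures.
From mathcomp Require Import all_boot all_order all_algebra.
Set Implicit Arguments.
Unset Strict Implicit.
Unset Printing Implicit Defensive.

Definition set_partition (n : nat) (sigma : {set {set 'I_n}}) : bool :=
  partition sigma [set: 'I_n].

Definition same_block (n : nat) (sigma : {set {set 'I_n}}) (i j : 'I_n) : bool :=
  [exists B in sigma, (i \in B) && (j \in B)].

Definition contains (n k : nat) (sigma : {set {set 'I_n}})
    (tau : {set {set 'I_k}}) : bool :=
  [exists x : {ffun 'I_k -> 'I_n},
    [forall i : 'I_k, forall j : 'I_k, (i < j) ==> (x i < x j)] &&
    [forall i : 'I_k, forall j : 'I_k,
      same_block sigma (x i) (x j) == same_block tau i j]].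

Definition avoids (n k : nat) (sigma : {set {set 'I_n}})
    (tau : {set {set 'I_k}}) : bool := ~~ contains sigma tau.

Definition A (k : nat) (tau : {set {set 'I_k}}) (n : nat) : nat :=
  #|[set sigma : {set {set 'I_n}} | set_partition sigma & avoids sigma tau]|.

Definition layered (k : nat) (tau : {set {set 'I_k}}) : bool :=
  [forall B in tau, exists a : 'I_k, exists b : 'I_k,
    B == [set i : 'I_k | a <= i <= b]].

From mathcomp Require Import all_classical all_reals all_analysis.
Import Order.TTheory GRing.Theory Num.Theory.
Import numFieldNormedType.Exports.
Local Open Scope ring_scope.

(* Only meaningful for n >= 2: the denominator vanishes at n = 0 and n = 1. *)
Definition F (R : realType) (k : nat) (tau : {set {set 'I_k}}) (n : nat) : R :=
  ln (A tau n)%:R / (n%:R * ln n%:R).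

(* Main.v *)
(** Let [d = k - r], the number of [i] such that [i - 1] and [i] share a block of
    [tau].

    Upper bound.  Let [b] be the size of the first block of [tau].  Take the
    shortest initial segment of [n] in which some block [B] of [sigma] has [b]
    elements, then continue greedily to its right with the next block of [tau],
    never reusing [B].  If [sigma] avoids [tau] this gets stuck.  A block of
    [sigma] that was not selected has at most [b - 1] elements in the segment
    of each block size [b], hence at most [d] elements in total.  So all but at
    most [k] blocks of [sigma] have size at most [d].  Labelling each element by
    the large block that contains it, or else by a representative of its block,
    all but a proportion [1 - 1/d] of the elements have O(1) possible labels.

    Lower bound.  Cut [n] into [d] intervals of length [m], up to O(1) leftover
    elements, and let every block meet each interval in exactly one element:
    there are [m!^(d-1)] such partitions.  In a copy of [tau], each of the [d]
    steps inside a block of [tau] moves to a later interval, so [d + 1]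
    intervals would be needed. *)
Require Import Defs.
From mathcomp Require Import all_boot all_order all_fingroup all_algebra.
Set Implicit Arguments.
Unset Strict Implicit.
Unset Printing Implicit Defensive.

(** * Partitions as kernels of labellings, and the steps of a layered partition *)

Lemma same_blockE n (sigma : {set {set 'I_n}}) (x y : 'I_n) :
  set_partition sigma ->
  same_block sigma x y = (pblock sigma x == pblock sigma y).
Proof.
case/and3P=> /eqP cov triv _.
rewrite eq_pblock ?cov ?inE //; apply/existsP/idP.
  by case=> B /and3P[Bs xB yB]; rewrite (def_pblock triv Bs xB).
move=> yx; exists (pblock sigma x).
by rewrite pblock_mem ?cov ?inE // mem_pblock cov inE.
Qed.

Lemma same_block_preim n (U : eqType) (f : 'I_n -> U) (x y : 'I_n) :
  same_block (preim_partition f [set: 'I_n]) x y = (f x == f y).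
Proof.
have part := preim_partitionP f [set: 'I_n].
rewrite same_blockE //; case/and3P: (part) => /eqP cov triv _.
rewrite eq_pblock ?cov ?inE // pblock_equivalence_partition ?inE //.
by move=> a b c _ _ _; split=> // /eqP->.
Qed.

Lemma preim_partition_id n (U : eqType) (f : 'I_n -> U)
    (sigma : {set {set 'I_n}}) :
  set_partition sigma -> (forall x y, (f x == f y) = same_block sigma x y) ->
  preim_partition f [set: 'I_n] = sigma.
Proof.
move=> part fE; rewrite -[RHS](equivalence_partition_pblock part).
apply: eq_in_imset => x _; apply/setP=> y; rewrite !inE.
case/and3P: (part) => /eqP cov triv _.
by rewrite fE same_blockE // eq_pblock ?cov ?inE.
Qed.

(* [set0] when [n <= z]. *)
Definition block_at n (sigma : {set {set 'I_n}}) (z : nat) : {set 'I_n} :=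
  oapp (pblock sigma) set0 (insub z).

Lemma block_at_ord n (sigma : {set {set 'I_n}}) (i : 'I_n) :
  block_at sigma i = pblock sigma i.
Proof. by rewrite /block_at valK. Qed.

Lemma layered_convex k (tau : {set {set 'I_k}}) (i j l : nat) :
  set_partition tau -> layered tau -> i <= j <= l -> l < k ->
  block_at tau i = block_at tau l -> block_at tau j = block_at tau i.
Proof.
move=> part lay /andP[ij jl] lk.
have jk := leq_ltn_trans jl lk; have ik := leq_ltn_trans ij jk.
rewrite -[i]/(val (Ordinal ik)) -[j]/(val (Ordinal jk)) -[l]/(val (Ordinal lk)).
rewrite !block_at_ord => /eqP; rewrite -same_blockE // => /exists_inP[B Btau].
case/andP=> iB lB; have /forall_inP/(_ B Btau) := lay.
case/existsP=> a /existsP[b /eqP eB].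
move: iB lB; rewrite eB !inE /= => /andP[ai _] /andP[_ lb].
apply/eqP; rewrite -same_blockE //; apply/exists_inP; exists B => //.
by rewrite eB !inE /= ai (leq_trans ai ij) (leq_trans jl lb)
  (leq_trans ij (leq_trans jl lb)).
Qed.

(** Blocks are intervals, so the positions that are not steps are exactly the minima of the blocks,
    one for each block. *)
Lemma layered_steps k (tau : {set {set 'I_k}}) :
  set_partition tau -> layered tau ->
  \sum_(1 <= i < k) (block_at tau i.-1 == block_at tau i) + #|tau| = k.
Proof.
move=> part lay; case/and3P: (part) => /eqP cov triv n0.
pose step (i : nat) := (0 < i) && (block_at tau i.-1 == block_at tau i).
pose starts := [set i : 'I_k | ~~ step i].
have -> : \sum_(1 <= i < k) (block_at tau i.-1 == block_at tau i)
    = #|~: starts|.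
  transitivity (\sum_(0 <= i < k) (step i : nat)).
    have [k0|k0] := posnP k; first by rewrite !big_geq ?k0.
    rewrite [RHS]big_ltn // add0n; apply: eq_big_nat => i /andP[i0 _].
    by rewrite /step i0.
  rewrite big_mkord -sum1_card [RHS]big_mkcond; apply: eq_bigr => i _.
  by rewrite !inE negbK; case: (step i).
have -> : tau = [set pblock tau i | i in starts].
  apply/setP=> B; apply/idP/imsetP => [Bt|[i _ ->]]; last first.
    by rewrite pblock_mem ?cov ?inE.
  have [i0 i0B] : exists i0, i0 \in B.
    by apply/set0Pn; apply: contraNneq n0 => <-.
  case: (arg_minnP (fun i : 'I_k => val i) i0B) => i iB min_i.
  exists i; last by rewrite (def_pblock triv Bt iB).
  rewrite inE /step; apply/negP => /andP[igt0 /eqP].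
  have pk : i.-1 < k by apply: leq_ltn_trans (leq_pred i) (ltn_ord i).
  rewrite -[i.-1]/(val (Ordinal pk)) !block_at_ord (def_pblock triv Bt iB) => e.
  have : Ordinal pk \in B by rewrite -e mem_pblock cov inE.
  by move/min_i => /=; rewrite leqNgt prednK ?leqnn.
rewrite card_in_imset; first by rewrite addnC cardsC card_ord.
move=> i j; rewrite !inE => si sj e; apply/val_inj.
wlog ij : i j si sj e / i < j.
  move=> H; case: (ltngtP (val i) (val j)) => // lt; first exact: H.
  by symmetry; apply: H.
case/negP: sj; rewrite /step (leq_ltn_trans _ ij) //=.
have jj : j.-1 < k by apply: leq_ltn_trans (leq_pred j) (ltn_ord j).
rewrite (layered_convex part lay (i := i) (l := j)) ?block_at_ord ?e //.
by rewrite leq_pred andbT -ltnS prednK // (leq_ltn_trans _ ij).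
Qed.

(** * Upper bound: greedy embedding of the pattern *)

(** The state of the search is made explicit for the induction: pattern positions before [p] are
    placed, only host points from [a] on remain, and the colours in [E] are spent. If the search
    gets stuck, [S] consists of the spent colours, with one new colour for each block placed. *)
Lemma greedy_embedding (T : finType) (U : eqType) (f : nat -> T)
    (t : nat -> U) (n k : nat)
    (conv : forall i j l, i <= j <= l -> l < k -> t i = t l -> t j = t i)
    (p a : nat) (E : {set T}) :
  p <= k -> a <= n ->
  (exists y : nat -> nat,
    [/\ forall i, p <= i < k -> a <= y i < n /\ f (y i) \notin E,
        forall i j, p <= i -> i < j -> j < k -> y i < y j &
        forall i j, p <= i < k -> p <= j < k ->
          (f (y i) == f (y j)) = (t i == t j)]) \/
  (exists S : {set T},
    [/\ #|S| <= #|E| + (k - p), E \subset S &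
        forall l, l \notin S ->
          count (fun z => f z == l) (index_iota a n)
            <= \sum_(p.+1 <= i < k) (t i.-1 == t i)]).
Proof.
have [m] := ubnP (k - p); elim: m => // m IH in p a E *.
rewrite ltnS => kpm pk an.
case: (ltngtP p k) pk => // [pk _|-> _]; last first.
  left; exists id; split=> [i /andP[ki]|i j ki ij|i j /andP[ki]].
  - by rewrite ltnNge ki.
  - by rewrite ltnNge (leq_trans ki (ltnW ij)).
  - by rewrite ltnNge ki.
(* The least such [q] ends the pattern block of [p]; by convexity the value [t p] does not return
   after it. *)
pose next q := (p < q) && ((q == k) || (t q != t p)).
have exq : exists q, next q by exists k; rewrite /next pk eqxx.
case: (ex_minnP exq) => q /andP[pq qP] qmin.
have qk : q <= k by apply: qmin; rewrite /next pk eqxx.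
have tq i : p <= i -> i < q -> t i = t p.
  rewrite leq_eqVlt => /predU1P[-> //|pi] iq; apply/eqP.
  apply: contraTT iq => nt; rewrite -leqNgt; apply: qmin.
  by rewrite /next pi nt orbT.
have tkq i : q <= i -> i < k -> t i != t p.
  move=> qi ik; apply/eqP => e.
  case/orP: qP => [/eqP eqk|]; first by rewrite eqk leqNgt ik in qi.
  by rewrite (conv p q i) ?eqxx ?e // (ltnW pq).
(* The block [[p, q)] accounts for [q - p.+1] steps, and the boundary term at [q] is dropped. *)
have sumE : q - p.+1 + \sum_(q.+1 <= i < k) (t i.-1 == t i)
    <= \sum_(p.+1 <= i < k) (t i.-1 == t i).
  rewrite [leqRHS](big_cat_nat (n := q)) //=; apply: leq_add.
    rewrite (@eq_big_nat _ _ _ _ _ _ (fun=> 1)) ?sum_nat_const_nat ?muln1 //.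
    move=> i /andP[pi iq]; rewrite !tq ?eqxx ?(ltnW pi) //.
      by rewrite -ltnS prednK // (leq_ltn_trans _ pi).
    by apply: leq_ltn_trans (leq_pred i) iq.
  case: (ltngtP q k) qk => // [qk _|-> _]; last by rewrite big_geq.
  by rewrite [leqRHS]big_ltn // leq_addl.
pose heavy x := [exists l : T, (l \notin E) &&
  (q - p <= count (fun z => f z == l) (index_iota a x))].
have [hn|/existsPn light] := boolP (heavy n); last first.
  (* Stuck here: every fresh colour occurs at most [q - p.+1] times in all of [[a, n)]. *)
  right; exists E; split; rewrite ?leq_addr // => l lE.
  have := light l; rewrite lE /= -ltnNge => lt.
  apply: leq_trans sumE; apply: leq_trans (leq_addr _ _).
  by rewrite subnS -ltnS prednK ?subn_gt0.
case: (ex_minnP (ex_intro heavy n hn)) => x /existsP[l /andP[lE hx]] xmin.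
have xn : x <= n by apply: xmin.
pose s := [seq z <- index_iota a x | f z == l].
have size_s : q - p <= size s by rewrite size_filter.
have ax : a < x.
  rewrite ltnNge; apply/negP => xa; move: hx.
  by rewrite /index_iota (eqP xa) /= leqNgt subn_gt0 pq.
have sP z : z \in s -> [/\ a <= z, z < x & f z = l].
  by rewrite mem_filter mem_index_iota => /and3P[/eqP].
have s_sorted : sorted ltn s.
  by rewrite sorted_filter ?iota_ltn_sorted //; apply: ltn_trans.
have nth_s i : p <= i -> i < q -> nth 0 s (i - p) \in s.
  by move=> pi iq; rewrite mem_nth // (leq_trans _ size_s) // ltn_sub2r.
have [|//|//|[y [yE ylt yf]]|[S [cS ES Sl]]] := IH q x (l |: E).
- by apply: leq_trans kpm; apply: ltn_sub2l.
(* The current block goes to the first occurrences of [l] in [[a, x)]; the remaining positions come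
   from the recursion, which stays in [[x, n)] and avoids [l]. *)
- left; exists (fun i => if i < q then nth 0 s (i - p) else y i); split.
  + move=> i /andP[pi ik]; case: ltnP => iq.
      have [ay yx ->] := sP _ (nth_s i pi iq).
      by rewrite ay (leq_trans yx xn).
    have [|/andP[xy ->]] := yE i; first by rewrite iq.
    by rewrite !inE negb_or (leq_trans (ltnW ax) xy) => /andP[_ ->].
  + move=> i j pi ij jk; case: (ltnP j q) => jq.
      rewrite (ltn_trans ij jq); apply: (sorted_ltn_nth ltn_trans 0 s_sorted).
      * by rewrite inE (leq_trans _ size_s) // ltn_sub2r // (ltn_trans ij jq).
      * by rewrite inE (leq_trans _ size_s) // ltn_sub2r.
      * by rewrite ltn_sub2r // (leq_ltn_trans pi ij).
    case: (ltnP i q) => iq; last exact: ylt.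
    have [_ yx _] := sP _ (nth_s i pi iq).
    have [|/andP[xy _] _] := yE j; first by rewrite jq.
    exact: leq_trans xy.
  + have mixed i j : p <= i < q -> q <= j < k ->
        (f (nth 0 s (i - p)) == f (y j)) = (t i == t j).
      move=> /andP[pi iq] /andP[qj jk].
      have [_ _ ->] := sP _ (nth_s i pi iq); rewrite (tq i) //.
      have [|_] := yE j; first by rewrite qj.
      rewrite !inE negb_or => /andP[/negPf nl _].
      by rewrite eq_sym nl eq_sym (negPf (tkq j qj jk)).
    move=> i j /andP[pi ik] /andP[pj jk].
    case: (ltnP i q) => iq; case: (ltnP j q) => jq.
    * have [_ _ ->] := sP _ (nth_s i pi iq).
      have [_ _ ->] := sP _ (nth_s j pj jq).
      by rewrite !tq ?eqxx.
    * by apply: mixed; rewrite ?pi ?jq.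
    * by rewrite eq_sym mixed ?pj ?iq // eq_sym.
    * by apply: yf; rewrite ?iq ?jq.
right; exists S; split; first 1 last.
- by apply: subset_trans ES; apply: subsetUr.
- move=> l' l'S; apply: leq_trans sumE.
  have catE u v w (P : pred nat) : u <= v -> v <= w ->
      count P (index_iota u w)
      = count P (index_iota u v) + count P (index_iota v w).
    move=> uv vw; rewrite -count_cat; congr count.
    rewrite /index_iota -{1}(subnKC vw) addnC -addnBA // addnC iotaD.
    by rewrite subnKC.
  rewrite (catE a x n) ?(ltnW ax) //; apply: leq_add (Sl _ l'S).
  have ax1 : a <= x.-1 by rewrite -ltnS prednK // (leq_ltn_trans _ ax).
  have x0 : 0 < x by apply: leq_ltn_trans ax.
  have one P : count P (index_iota x.-1 x) = P x.-1.
    by rewrite /index_iota -subn1 subKn //= addn0.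
  have few l0 : l0 \notin E ->
      count (fun z => f z == l0) (index_iota a x.-1) < q - p.
    move=> l0E; rewrite ltnNge; apply/negP => h.
    have /xmin : heavy x.-1 by apply/existsP; exists l0; rewrite l0E.
    by rewrite leqNgt prednK ?leqnn.
  (* By minimality of [x], the point [x.-1] completes the colour [l]. Any other fresh colour
     therefore has the same count on [[a, x)] as on [[a, x.-1)], which is below [q - p]. *)
  have fx : f x.-1 = l.
    apply/eqP; move: hx; rewrite (catE a x.-1 x) ?leq_pred // one.
    by case: eqP => // _; rewrite addn0 leqNgt few.
  have [l'E /negPf l'l] : l' \notin E /\ l' != l.
    have : l' \notin l |: E by apply: contra l'S; apply: (subsetP ES).
    by rewrite !inE negb_or => /andP[].
  rewrite (catE a x.-1 x) ?leq_pred // one fx eq_sym l'l addn0.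
  by rewrite subnS -ltnS prednK ?subn_gt0 // few.
(* The new colour [l] costs one unit, paid for by [p < q]. *)
- apply: leq_trans cS _; rewrite cardsU1 lE -addnA addnCA leq_add2l.
  by rewrite add1n ltn_sub2l.
Qed.

(** When each point is coloured by its block, the number of occurrences of a colour bounds the block
    size, and [layered_steps] evaluates the sum of steps. *)
Lemma avoids_small_blocks n k (tau : {set {set 'I_k}})
    (sigma : {set {set 'I_n}}) :
  set_partition tau -> layered tau -> set_partition sigma ->
  avoids sigma tau ->
  exists2 S : {set {set 'I_n}}, #|S| <= k &
    forall B, B \in sigma -> B \notin S -> #|B| <= k - #|tau|.
Proof.
move=> ptau ltau psig; case/and3P: (psig) => /eqP cov triv _.
have conv i j l := @layered_convex k tau i j l ptau ltau.
have [[y [yb ylt yf]]|[S [cS _ SP]] _] := @greedy_embedding _ _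
  (block_at sigma) (block_at tau) n k conv 0 0 set0 (leq0n k) (leq0n n).
  case/negP; have yn (i : 'I_k) : y i < n.
    by have [|/andP[]] := yb i; first exact: ltn_ord.
  apply/existsP; exists [ffun i => Ordinal (yn i)].
  apply/andP; split; apply/forallP=> i; apply/forallP=> j; rewrite !ffunE.
    by apply/implyP => ij; apply: ylt.
  by rewrite !same_blockE // -!block_at_ord yf //= ltn_ord.
exists S; first by rewrite cards0 subn0 in cS.
move=> B Bs BS; have := SP B BS.
rewrite /index_iota subn0 -val_enum_ord count_map.
have <- : \sum_(1 <= i < k) (block_at tau i.-1 == block_at tau i)
    = k - #|tau|.
  by move/(congr1 (subn^~ #|tau|)): (layered_steps ptau ltau); rewrite addnK.
apply: leq_trans; rewrite cardE size_filter enumT.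
apply: sub_count => x xB /=.
by rewrite block_at_ord (def_pblock triv Bs xB).
Qed.

(** * Upper bound: counting partitions through labellings *)

(* A label [inl y] names a block by its element [y], and [inr i] names the
   [i]-th large block. *)
Definition moved n k (f : {ffun 'I_n -> 'I_n + 'I_k}) : {set 'I_n} :=
  [set x | if f x is inl y then y != x else false].

(** Fix the moved set [N], for which [2 ^ n] bounds the choices. A point of [N] has at most [n]
    labels; any other point [x] has only [inl x] and the [k] labels [inr i]. The factor [k.+1] is
    granted to all points for simplicity. *)
Lemma card_few_moved n k M :
  0 < n ->
  #|[set f : {ffun 'I_n -> 'I_n + 'I_k} | #|moved f| <= M]|
    <= 2 ^ n * n ^ M * k.+1 ^ n.
Proof.
move=> n0.
pose G (N : {set 'I_n}) (x : 'I_n) : pred ('I_n + 'I_k) :=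
  [pred v | (if v is inl y then y != x else false) == (x \in N)].
have cG N x : #|G N x| <= if x \in N then n else k.+1.
  case: ifP => xN.
    have /subset_leq_card/leq_trans : G N x \subset codom inl.
      apply/subsetP=> -[y|i]; rewrite !inE xN // => _.
      exact: codom_f.
    by apply; apply: leq_trans (card_size _) _; rewrite size_codom card_ord.
  have /subset_leq_card/leq_trans : G N x \subset inl x :: codom inr.
    apply/subsetP=> -[y|i]; rewrite !inE xN ?codom_f ?orbT //.
    by rewrite eqbF_neg negbK => /eqP->; rewrite eqxx.
  by apply; apply: leq_trans (card_size _) _; rewrite /= size_codom card_ord.
have cF (N : {set 'I_n}) :
    #|family (G N)| <= n ^ #|N| * k.+1 ^ n.
  rewrite card_family foldrE big_map big_enum /=.
  apply: leq_trans (_ : \prod_(x : 'I_n)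
      ((if x \in N then n else 1) * k.+1) <= _).
    apply: leq_prod => x _; apply: leq_trans (cG N x) _.
    by case: ifP => _; rewrite ?mul1n // leq_pmulr.
  by rewrite big_split /= -big_mkcond !prod_nat_const card_ord.
have -> : 2 ^ n * n ^ M * k.+1 ^ n
    = \sum_(N : {set 'I_n}) n ^ M * k.+1 ^ n.
  by rewrite sum_nat_const -mulnA -{1}[n]card_ord -cardsT -card_powerset
    powersetT cardsT.
apply: leq_trans (_ : #|\bigcup_(N : {set 'I_n} | #|N| <= M)
    [set f in family (G N)]| <= _).
  apply: subset_leq_card; apply/subsetP => f; rewrite inE => fM.
  apply/bigcupP; exists (moved f) => //; rewrite inE; apply/familyP => x.
  by rewrite !inE.
rewrite [leqRHS](bigID (fun N : {set 'I_n} => #|N| <= M)) /=.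
apply: leq_trans (leq_addr _ _).
elim/big_rec2: _ => [|N b B NM IH]; first by rewrite cards0.
apply: leq_trans (leq_card_setU _ _) (leq_add _ IH).
rewrite cardsE; apply: leq_trans (cF N) _.
by rewrite leq_mul2r leq_pexp2l // orbT.
Qed.

(** A partition is the kernel of its labelling, so it suffices to bound the number of moved points.
    In a block of size [b <= d] outside [S] the representative does not move, and
    [b - 1 <= b * (d - 1) / d]; blocks in [S] contribute nothing. *)
Lemma card_few_large_blocks n k d :
  0 < n -> 0 < d ->
  #|[set sigma : {set {set 'I_n}} | set_partition sigma &
      [exists S : {set {set 'I_n}}, (#|S| <= k) &&
        [forall B in sigma, (B \notin S) ==> (#|B| <= d)]]]|
    <= 2 ^ n * n ^ ((n * d.-1) %/ d) * k.+1 ^ n.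
Proof.
move=> n0 d0; apply: leq_trans (card_few_moved k _ n0).
apply: leq_trans (leq_imset_card
  (fun f : {ffun 'I_n -> 'I_n + 'I_k} => preim_partition f [set: 'I_n]) _).
apply: subset_leq_card; apply/subsetP => sigma; rewrite inE.
case/andP=> part /existsP[S /andP[cS /forall_inP small]].
case/and3P: (part) => /eqP cov triv nz.
have pin x : x \in pblock sigma x by rewrite mem_pblock cov inE.
have psig x : pblock sigma x \in sigma by rewrite pblock_mem ?cov ?inE.
(* [pick] sees only the block, so [rep] is constant on blocks; the default never occurs, since [x]
   lies in its own block. *)
pose rep (x : 'I_n) := odflt x [pick y in pblock sigma x].
have rep_in x : rep x \in pblock sigma x.
  by rewrite /rep; case: pickP => [y //|/(_ x)]; rewrite pin.
have rep_eq x y : pblock sigma x = pblock sigma y -> rep x = rep y.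
  by rewrite /rep => ->; case: pickP => [//|/(_ y)]; rewrite pin.
pose rank x := index (pblock sigma x) (enum S).
(* The default [inl x] is never reached: the rank of a block of [S] is below [#|S| <= k]. *)
pose f := [ffun x : 'I_n =>
  if pblock sigma x \in S then oapp inr (inl x) (insub (rank x))
  else inl (rep x) : 'I_n + 'I_k].
have fS x : pblock sigma x \in S -> exists2 i, f x = inr i & i = rank x :> nat.
  move=> xS; rewrite ffunE xS.
  have rk : rank x < k.
    by apply: leq_trans cS; rewrite cardE index_mem mem_enum.
  by exists (Ordinal rk) => //; rewrite insubT.
have fN x : pblock sigma x \notin S -> f x = inl (rep x).
  by move=> /negPf xS; rewrite ffunE xS.
apply/imsetP; exists f; last first.
  symmetry; apply: preim_partition_id => // x y; rewrite same_blockE //.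
  apply/eqP/eqP => [|e]; last first.
    rewrite !ffunE (rep_eq _ _ e) /rank e; case: ifP => // yS.
    have [i] := fS _ yS; rewrite ffunE yS /rank.
    by case: insubP => //=.
  case: (boolP (pblock sigma x \in S)) => xS;
    case: (boolP (pblock sigma y \in S)) => yS.
  - have [i -> ei] := fS _ xS; have [j -> ej] := fS _ yS => -[eij].
    have := nth_index set0 (s := enum S); move=> ni.
    rewrite -(ni (pblock sigma x)) ?mem_enum //.
    by rewrite -/(rank x) -ei eij ej ni ?mem_enum.
  - by have [i -> _] := fS _ xS; rewrite fN.
  - by have [i -> _] := fS _ yS; rewrite fN.
  - rewrite !fN // => -[e]; apply/eqP; rewrite eq_pblock ?cov ?inE //.
    have := rep_in y; rewrite -e => ry.
    by rewrite -(same_pblock triv (rep_in x)) (same_pblock triv ry).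
rewrite inE leq_divRL // mulnC.
have blockM B : B \in sigma -> d * #|moved f :&: B| <= #|B| * d.-1.
  move=> Bs; case: (boolP (B \in S)) => BS.
    rewrite (_ : _ :&: _ = set0) ?cards0 ?muln0 //.
    apply/setP=> x; rewrite !inE; case: (boolP (x \in B)) => xB; last first.
      by rewrite andbF.
    by have [|i -> _] := fS x; rewrite // (def_pblock triv Bs xB).
  have [x xB] : exists x, x \in B.
    by apply/set0Pn; apply: contraNneq nz => <-.
  have pE := def_pblock triv Bs xB.
  have rB : rep x \in B by rewrite -pE.
  have lt : #|moved f :&: B| < #|B|.
    apply: proper_card; rewrite properE subsetIr /=.
    apply/subsetPn; exists (rep x) => //; rewrite !inE rB andbT.
    have prE := def_pblock triv Bs rB.
    rewrite fN ?prE //= negbK; apply/eqP; apply: rep_eq.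
    by rewrite pE.
  have Bd : #|B| <= d by have /implyP := small B Bs; apply.
  (* With [d] and [#|B|] both lowered by one, a moved count [t <= b <= d] gives
     [t + d * t <= d + b * d] term by term. *)
  case: d d0 Bd {small} => // d _ Bd; rewrite /= mulSn.
  case: #|B| lt Bd => // b; rewrite !ltnS => mb bd.
  rewrite mulSn; apply: leq_add; first exact: leq_trans bd.
  by rewrite mulnC leq_mul2r mb orbT.
have -> : n * d.-1 = \sum_(B in sigma) #|B| * d.-1.
  by rewrite -big_distrl /= -(card_partition part) cardsT card_ord.
have -> : #|moved f| = \sum_(B in sigma) #|moved f :&: B|.
  rewrite -sum1_card.
  transitivity (\sum_(x in [set: 'I_n] | x \in moved f) 1).
    by apply: eq_bigl => x; rewrite in_setT.
  rewrite (set_partition_big_cond _ part); apply: eq_bigr => B _.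
  by rewrite -sum1_card; apply: eq_bigl => x; rewrite in_setI andbC.
by rewrite big_distrr; apply: leq_sum => B; apply: blockM.
Qed.

Lemma A_upper k (tau : {set {set 'I_k}}) n :
  set_partition tau -> layered tau -> #|tau| < k -> 0 < n ->
  A tau n <= 2 ^ n * n ^ ((n * (k - #|tau|).-1) %/ (k - #|tau|)) * k.+1 ^ n.
Proof.
move=> ptau ltau tk n0.
apply: leq_trans (card_few_large_blocks k n0 _); last by rewrite subn_gt0.
apply: subset_leq_card; apply/subsetP => sigma; rewrite !inE.
case/andP=> psig av; rewrite psig /=.
have [S cS SP] := avoids_small_blocks ptau ltau psig av.
apply/existsP; exists S; rewrite cS /=; apply/forall_inP=> B Bs.
by apply/implyP; apply: SP.
Qed.

(** * Lower bound: partitions built from permutations *)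

(* The interval [0, m) carries the names of the blocks, and [pi q] distributes
   them over [(q+1)m, (q+2)m).  Elements from [(d+1)m] on are singletons, as are
   all elements when [m = 0]. *)
Definition perm_label n d m (pi : {ffun 'I_d -> {perm 'I_m}})
    (x : 'I_n) : nat :=
  if x < m then x : nat else
  if insub (x %/ m).-1 is Some q then
    if insub (x %% m) is Some s then pi q s : nat else x : nat
  else x : nat.

(** A label below [m] occurs at most once in each interval, because [pi q] is injective. Points
    beyond the intervals keep their own value, which is at least [m], so they share their label with
    no other point. *)
Lemma perm_labelP n d m (pi : {ffun 'I_d -> {perm 'I_m}}) (x y : 'I_n) :
  x < y -> perm_label pi x = perm_label pi y ->
  x %/ m < y %/ m <= d.
Proof.
rewrite /perm_label => xy.
have small (z : 'I_n) : m <= z -> 0 < m -> 0 < z %/ m.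
  by move=> mz m0; rewrite divn_gt0.
case: (ltnP y m) => ym.
  by rewrite (ltn_trans xy ym) => e; rewrite e ltnn in xy.
move/esym; case: insubP => [q qd qE|]; last first.
  rewrite -leqNgt => dy.
  case: (ltnP x m) => xm e; first by rewrite e ltnn in xy.
  move: e; case: insubP => [q' _ _|_]; last by move=> e; rewrite e ltnn in xy.
  case: insubP => [s' _ _ e|_]; last by move=> e; rewrite e ltnn in xy.
  by have := ltn_ord (pi q' s'); rewrite -e ltnNge ym.
case: insubP => [s sm sE|]; last first.
  rewrite -leqNgt => my.
  case: (ltnP x m) => xm e; first by rewrite e ltnn in xy.
  move: e; case: insubP => [q' _ _|_]; last by move=> e; rewrite e ltnn in xy.
  case: insubP => [s' _ _ e|_]; last by move=> e; rewrite e ltnn in xy.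
  by have := ltn_ord (pi q' s'); rewrite -e ltnNge ym.
have m0 : 0 < m by apply: leq_ltn_trans sm.
have y0 := small y ym m0.
have yd : y %/ m <= d by rewrite -(prednK y0).
rewrite yd andbT.
case: (ltnP x m) => xm; first by rewrite divn_small.
have x0 := small x xm m0.
have lexy : x %/ m <= y %/ m by apply: leq_div2r; apply: ltnW.
(* Equal quotients would select the same permutation, whose injectivity forces equal remainders and
   hence [x = y]. *)
rewrite ltn_neqAle lexy andbT => e; apply/eqP => qq.
move: e; rewrite qq -qE valK insubT ?ltn_pmod // => sx.
move/val_inj/perm_inj/(congr1 val); rewrite sE /= => ss.
by move: xy; rewrite (divn_eq x m) (divn_eq y m) qq ss ltnn.
Qed.

Lemma perm_label_avoids k (tau : {set {set 'I_k}}) n m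
    (pi : {ffun 'I_(k - #|tau|).-1 -> {perm 'I_m}}) :
  set_partition tau -> layered tau -> #|tau| < k ->
  avoids (preim_partition (perm_label (n := n) pi) [set: 'I_n]) tau.
Proof.
move=> ptau ltau tk; apply/existsP => -[x /andP[/forallP incr /forallP same]].
set d := (k - #|tau|) in pi same.
have d0 : 0 < d by rewrite subn_gt0.
(* Leftover points may have quotients above [d.-1]; the cap keeps the final value below [d]. It does
   not affect the end of a step, whose quotient is at most [d.-1] by [perm_labelP]. *)
pose q i := minn (oapp (fun i : 'I_k => x i %/ m) 0 (insub i)) d.-1.
have climb i : i < k ->
    \sum_(1 <= j < i.+1) (block_at tau j.-1 == block_at tau j) <= q i.
  elim: i => [|i IH] ik; first by rewrite big_geq.
  have ik' := ltnW ik; rewrite big_nat_recr //=.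
  have := IH ik'; rewrite /q !insubT /=.
  set X := Sub i ik'; set Y := Sub i.+1 ik.
  have /forallP/(_ Y)/implyP/(_ (ltnSn i)) xlt := incr X.
  have xyq : x X %/ m <= x Y %/ m by apply: leq_div2r; apply: ltnW.
  rewrite -[block_at tau i]/(block_at tau (val X)).
  rewrite -[block_at tau i.+1]/(block_at tau (val Y)).
  rewrite !block_at_ord -same_blockE //.
  have /forallP/(_ Y)/eqP <- := same X; rewrite same_block_preim => le.
  case: eqP => [/(perm_labelP xlt)/andP[lt yd]|_]; last first.
    rewrite addn0; apply: leq_trans le _.
    by rewrite leq_min geq_minr andbT; apply: leq_trans (geq_minl _ _) xyq.
  rewrite addn1 (minn_idPl yd); apply: leq_ltn_trans le _.
  by apply: leq_ltn_trans lt; apply: geq_minl.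
have k0 : 0 < k by apply: leq_ltn_trans tk.
have := climb k.-1; rewrite !prednK // leqnn => /(_ isT).
have <- : d = \sum_(1 <= i < k) (block_at tau i.-1 == block_at tau i).
  by move/(congr1 (subn^~ #|tau|)): (layered_steps ptau ltau); rewrite addnK.
by move/leq_trans/(_ (geq_minr _ _)); rewrite -ltnS prednK // ltnn.
Qed.

(** Points of [[0, m)] label themselves whatever [pi] is, so [pi q s] can be read off as the point
    of [[0, m)] in the block of [q.+1 * m + s]. *)
Lemma perm_label_inj n d m : m * d.+1 <= n ->
  injective (fun pi : {ffun 'I_d -> {perm 'I_m}} =>
    preim_partition (perm_label (n := n) pi) [set: 'I_n]).
Proof.
move=> mdn pi pi' e; apply/ffunP=> q; apply/permP=> s.
have m0 : 0 < m by apply: leq_ltn_trans (ltn_ord s).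
have xn : q.+1 * m + s < n.
  apply: (@leq_trans (q.+2 * m)).
    by rewrite [q.+2 * m]mulSn addnC ltn_add2r.
  by apply: leq_trans mdn; rewrite mulnC leq_mul2l ltnS ltn_ord orbT.
have yn : pi q s < n.
  apply: leq_trans mdn; apply: leq_trans (ltn_ord _) _.
  by rewrite leq_pmulr.
have lx pi0 : perm_label pi0 (Ordinal xn) = pi0 q s.
  have -> : perm_label pi0 (Ordinal xn)
      = if q.+1 * m + s < m then q.+1 * m + s else pi0 q s.
    rewrite /perm_label /= divnMDl // modnMDl divn_small // modn_small //.
    by rewrite addn0 !valK.
  by rewrite ltnNge mulSn -addnA leq_addr.
have ly (pi0 : {ffun 'I_d -> {perm 'I_m}}) :
    perm_label pi0 (Ordinal yn) = pi q s :> nat.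
  by rewrite /perm_label /= ltn_ord.
have := same_block_preim (perm_label pi) (Ordinal xn) (Ordinal yn).
rewrite lx ly eqxx; have /= -> := e; rewrite same_block_preim lx ly.
by move/eqP/val_inj.
Qed.

Lemma A_lower k (tau : {set {set 'I_k}}) n :
  set_partition tau -> layered tau -> #|tau| < k ->
  (n %/ (k - #|tau|))`! ^ (k - #|tau|).-1 <= A tau n.
Proof.
move=> ptau ltau tk; have d0 : 0 < k - #|tau| by rewrite subn_gt0.
set m := n %/ _.
have mdn : m * (k - #|tau|).-1.+1 <= n by rewrite prednK // leq_trunc_div.
have := card_imset predT (perm_label_inj mdn).
rewrite card_ffun card_ord card_Sn => <-.
apply: subset_leq_card; apply/subsetP => _ /imsetP[pi _ ->].
by rewrite inE [set_partition _]preim_partitionP perm_label_avoids.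
Qed.

(** * Factorial estimates *)

Lemma leq_wexp2r m n e : m <= n -> m ^ e <= n ^ e.
Proof. by case: e => // e mn; rewrite leq_exp2r. Qed.

(** The falling factorial [m.*2 ^_ m] is at least [m ^ m] and equals a central binomial coefficient
    times the factorial; that coefficient is at most [2 ^ m.*2]. *)
Lemma expnn_le_fact m : m ^ m <= 4 ^ m * m`!.
Proof.
have -> : 4 ^ m = (1 + 1) ^ m.*2 by rewrite -mul2n expnM.
apply: leq_trans (_ : m.*2 ^_ m <= _).
  rewrite ffact_prod -[X in _ ^ X]card_ord -prod_nat_const.
  apply: leq_prod => i _; apply: leq_trans (leq_sub2l _ (ltnW (ltn_ord i))).
  by rewrite -addnn addnK.
rewrite -bin_ffact leq_mul2r; apply/orP; right; rewrite expnDn.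
have mm : m < m.*2.+1 by rewrite ltnS -addnn leq_addr.
by rewrite (bigD1 (Ordinal mm)) //= !exp1n !muln1 leq_addr.
Qed.

(** With [m = n %/ d] it suffices that [n ^ m.+1 <= (16 * d) ^ n * m!]. Here 16 is the product of 2
    from [n <= 2 * d * m], 4 from [expnn_le_fact], and 2 from absorbing the spare factor
    [n <= 2 ^ n]. *)
Lemma expn_divn_le_fact n d : 0 < n -> 0 < d ->
  n ^ ((n %/ d).+1 * d.-1) <= ((16 * d) ^ d.-1) ^ n * (n %/ d)`! ^ d.-1.
Proof.
move=> n0 d0; rewrite expnM [((16 * d) ^ _) ^ n]expnAC -expnMn.
set m := n %/ d; apply: leq_wexp2r.
rewrite expnSr.
have mn : m <= n by apply: leq_div.
have -> : 16 * d = 8 * d * 2 by rewrite mulnAC.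
rewrite [(8 * d * 2) ^ n]expnMn mulnAC.
apply: leq_mul (ltnW (ltn_expl n (ltnSn 1))).
apply: leq_trans (_ : (8 * d) ^ m * m`! <= _); last first.
  by rewrite leq_mul2r leq_pexp2l ?orbT // muln_gt0.
(* The bound [n < m.+1 * d <= 2 * d * m] relies on [m >= 1]. *)
have [->|m0] := posnP m; first by [].
apply: leq_trans (_ : (2 * d * m) ^ m <= _).
  apply: leq_wexp2r; apply: leq_trans (ltnW (ltn_ceil n d0)) _.
  rewrite -/m [2 * d]mulnC -mulnA [m.+1 * d]mulnC; apply: leq_mul => //.
  by rewrite mul2n -addnn -addn1 leq_add2l.
have -> : 8 * d = 2 * d * 4 by rewrite mulnAC.
rewrite [(2 * d * m) ^ m]expnMn [(2 * d * 4) ^ m]expnMn -mulnA.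
by rewrite leq_mul2l expnn_le_fact orbT.
Qed.

(* Real exponents and the limit *)
From mathcomp Require Import all_classical all_reals all_analysis.
From mathcomp Require Import ring.
Import Order.TTheory GRing.Theory Num.Theory.
Import numFieldNormedType.Exports.
Local Open Scope classical_set_scope.
Local Open Scope ring_scope.

(** Taking logarithms squeezes the ratio between [ln c / ln n + a] and [ln C / ln n + a]. *)
Lemma cvg_ln_ratio (R : realType) (u : nat -> R) (c C a : R) :
  0 < c -> 0 < C ->
  (forall n, (1 <= n)%N ->
     c ^+ n * n%:R `^ (n%:R * a) <= u n <= C ^+ n * n%:R `^ (n%:R * a)) ->
  ln (u n) / (n%:R * ln n%:R) @[n --> \oo] --> a.
Proof.
move=> c0 C0 bound.
have bnd (b : R) : (b / ln n%:R + a) @[n --> \oo] --> a.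
  rewrite -[X in _ --> X]add0r; apply: cvgD; last exact: cvg_cst.
  rewrite -[X in _ --> X](mulr0 b); apply: cvgMr.
  apply/gtr0_cvgV0.
    near=> n; apply: ln_gt0; rewrite (ltr_nat R 1).
    by near: n; exact: nbhs_infty_ge.
  apply/cvgryPge => M; near=> n.
  rewrite -[M]expRK ler_ln ?posrE ?expR_gt0 ?ltr0n //.
    by near: n; exact: nbhs_infty_ger.
  by near: n; exact: nbhs_infty_ge.
apply: (squeeze_cvgr _ (bnd (ln c)) (bnd (ln C))).
near=> n.
have n2 : (2 <= n)%N by near: n; exact: nbhs_infty_ge.
have n0 : (0 < n)%N by apply: leq_trans n2.
have nR : 0 < n%:R :> R by rewrite ltr0n.
have L0 : 0 < ln n%:R :> R by apply: ln_gt0; rewrite (ltr_nat R 1).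
have lnE (b : R) : 0 < b ->
    ln b / ln n%:R + a = ln (b ^+ n * n%:R `^ (n%:R * a)) / (n%:R * ln n%:R).
  move=> b0; rewrite lnM ?posrE ?exprn_gt0 ?powR_gt0 // lnXn // ln_powR.
  move: (ln n%:R) L0 => L L0.
  by rewrite -mulr_natl; field; rewrite !gt_eqF.
have /andP[lo hi] := bound n n0.
have lo0 : 0 < c ^+ n * n%:R `^ (n%:R * a) :> R.
  by rewrite mulr_gt0 ?exprn_gt0 ?powR_gt0.
have u0 := lt_le_trans lo0 lo; have hi0 := lt_le_trans u0 hi.
rewrite !lnE // !ler_pM2r ?invr_gt0 ?mulr_gt0 //.
by rewrite !ler_ln ?posrE // lo hi.
Unshelve. all: by end_near.
Qed.

Unset Implicit Arguments.

Theorem theorem2 (R : realType) (k r : nat) (tau : {set {set 'I_k}})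
    (tau_partition : set_partition tau) (tau_layered : layered tau)
    (tau_blocks : #|tau| = r) (r_lt_k : (r < k)%N) :
  (exists c C : R, [/\ 0 < c, c <= C &
     forall n : nat, (1 <= n)%N ->
       c ^+ n * n%:R `^ (n%:R * (1 - 1 / (k%:R - r%:R))) <= (A tau n)%:R /\
       (A tau n)%:R <= C ^+ n * n%:R `^ (n%:R * (1 - 1 / (k%:R - r%:R)))]) /\
  F R tau n @[n --> \oo] --> (1 - 1 / (k%:R - r%:R) : R).
Proof.
subst r; rewrite -natrB; last exact: ltnW.
have d0 : (0 < k - #|tau|)%N by rewrite subn_gt0.
have lower n := A_lower n tau_partition tau_layered r_lt_k.
have upper n := A_upper tau_partition tau_layered r_lt_k (n := n).
set d := (k - #|tau|)%N in d0 lower upper *.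
pose a : R := 1 - 1 / d%:R; rewrite -/a.
have dR : 0 < d%:R :> R by rewrite ltr0n.
have aE : a = d.-1%:R / d%:R.
  by rewrite /a -subn1 (natrB _ d0) mulrBl divff // gt_eqF.
(* [c] inverts the base in [expn_divn_le_fact]; [C] merges the factors [2 ^ n] and [k.+1 ^ n] of
   [A_upper]. *)
pose c : R := (((16 * d) ^ d.-1)%N%:R)^-1.
pose C : R := (2 * k.+1)%N%:R.
have c0 : 0 < c by rewrite invr_gt0 ltr0n expn_gt0 muln_gt0 d0.
have C0 : 0 < C by rewrite ltr0n.
have bound n : (1 <= n)%N ->
    c ^+ n * n%:R `^ (n%:R * a) <= (A tau n)%:R
      <= C ^+ n * n%:R `^ (n%:R * a).
  move=> n0; have n1 : 1 <= n%:R :> R by rewrite (ler_nat R 1).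
  apply/andP; split.
    rewrite exprVn mulrC ler_pdivrMr; last first.
      by rewrite exprn_gt0 // ltr0n expn_gt0 muln_gt0 d0.
    (* The real exponent [n * a = n * (d - 1) / d] is rounded up to an integer, using
       [n < (n %/ d).+1 * d]. *)
    apply: (@le_trans _ _ (n ^ ((n %/ d).+1 * d.-1))%N%:R).
      rewrite natrX -powR_mulrn ?ler0n //; apply: ler_powR => //.
      rewrite aE mulrA ler_pdivrMr // -!natrM ler_nat mulnAC.
      by rewrite leq_mul2r ltnW ?orbT // ltn_ceil.
    rewrite -natrX -natrM ler_nat.
    apply: leq_trans (expn_divn_le_fact n0 d0) _.
    by rewrite mulnC leq_mul2r lower orbT.
  apply: (@le_trans _ _ (2 ^ n * n ^ ((n * d.-1) %/ d) * k.+1 ^ n)%N%:R).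
    by rewrite ler_nat upper.
  rewrite mulnAC -expnMn natrM natrX ler_wpM2l ?exprn_ge0 ?(ltW C0) //.
  rewrite natrX -powR_mulrn ?ler0n //; apply: ler_powR => //.
  by rewrite aE mulrA ler_pdivlMr // -!natrM ler_nat leq_trunc_div.
split; last exact: cvg_ln_ratio c0 C0 bound.
exists c, C; split=> // [|n n0]; last by apply/andP; exact: bound.
(* At [n = 1] the power of [n] is 1, and the two bounds give [c <= C]. *)
have /andP[lo hi] := bound 1 isT.
by move: (le_trans lo hi); rewrite !expr1 mul1r powR1 !mulr1.
Qed.
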